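(* For every $k\ge 2$, \[\varepsilon_{k+1,3}=2\cdot 3^{\frac{\varepsilon_{k,3}-1}{4}}-1.\]
   Context: For a base $b\ge 2$, every $a\in\mathbb{Z}^+$ has a base $b$ expansion $a=\sum_{i=0}^n a_ib^i$ with $0\le a_i<b$ and leading digit $a_n\ne 0$. The $b$-elated function $E_{2,b}:\mathbb{Z}^+\to\mathbb{Z}^+$ is defined by $E_{2,b}(a)=a_n\sum_{i=0}^n a_i^2$. A $b$-elated number is an $a\in\mathbb{Z}^+$ with $E_{2,b}^m(a)=1$ for some $m\ge 0$ (iteration); its height is the smallest such $m$. $\varepsilon_{k,b}$ denotes the smallest $b$-elated number of height $k$. *)

(* Defs.v *)
From mathcomp Require Import all_boot.

Set Implicit Arguments.
Unset Strict Implicit.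
Unset Printing Implicit Defensive.

Definition digit (b a i : nat) : nat := (a %/ b ^ i) %% b.

(* Index of the leading digit: for 1 < b and 0 < a, [trunc_log b a] is the     *)
(* largest n with b ^ n <= a.                                                  *)
Definition lead_index (b a : nat) : nat := trunc_log b a.

Definition elated_fun (b a : nat) : nat :=
  digit b a (lead_index b a) * \sum_(i < (lead_index b a).+1) digit b a i ^ 2.

(* Positive integers are natural numbers a with 0 < a; for 1 < b, [elated_fun] *)
(* maps positive integers to positive integers.                                *)
Definition elated (b a : nat) : Prop :=
  0 < a /\ exists m : nat, iter m (elated_fun b) a = 1.

Definition has_height (b a k : nat) : Prop :=
  iter k (elated_fun b) a = 1 /\
  forall m : nat, iter m (elated_fun b) a = 1 -> k <= m.

(* [is_epsilon k b e] reads "epsilon_{k,b} exists and equals e".               *)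
Definition is_epsilon (k b e : nat) : Prop :=
  [/\ elated b e, has_height b e k &
      forall a : nat, elated b a -> has_height b a k -> e <= a].

(* Main.v *)
Require Import Defs.
From mathcomp Require Import all_boot.
From mathcomp Require Import zify.

(** In an odd base [b] every power [b ^ i] is odd, so [a], its digit sum and the
    sum of its squared digits all have the same parity.  Hence [elated_fun]
    maps even numbers to even numbers, and as 1 is odd every elated number is
    odd ([elated_odd]).  The image of an elated number is elated, hence odd, and
    the leading digit divides it, so the leading digit is odd as well
    ([elated_odd_lead]).  In base 3 this forces the leading digit 1, and for a
    number with [n] lower digits the value of [elated_fun] is then 1 plus at
    most [4 * n].  The least number with a value of at least [1 + 4 * m] is
    therefore a 1 followed by [m] twos: this is [2 * 3 ^ m - 1], and its value
    is exactly [1 + 4 * m]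
    ([repdigit_tail_minimal], [elated_fun_repdigit_tail]).

    A number has height [k + 1] (with [k > 0]) exactly when its image has height
    [k], so if [1 + 4 * m] is the least elated number of height [k], then
    [2 * 3 ^ m - 1] is the least one of height [k + 1] ([epsilon_step]).  It is
    again congruent to 1 modulo 4, since [3 ^ m] is odd, so the argument
    repeats; it starts from the value 13 for height 2, which is checked by
    evaluation ([epsilon2]). *)

(** * Digits in base b *)

Lemma ltn_digit {b} a i : 0 < b -> digit b a i < b.
Proof. by move=> b0; rewrite ltn_mod. Qed.

Lemma sum_digits_mod b a n :
  \sum_(i < n) digit b a i * b ^ i = a %% b ^ n.
Proof.
elim: n => [|n IHn]; first by rewrite big_ord0 expn0 modn1.
rewrite big_ord_recr /= IHn /digit modn_divl -expnS.
rewrite [RHS](divn_eq _ (b ^ n)) addnC modn_dvdm //.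
by rewrite dvdn_exp2l.
Qed.

Lemma sum_digits {b} a : 1 < b ->
  a = \sum_(i < lead_index b a) digit b a i * b ^ i
      + digit b a (lead_index b a) * b ^ lead_index b a.
Proof.
move=> b1; have := sum_digits_mod b a (lead_index b a).+1.
by rewrite big_ord_recr /= modn_small ?trunc_log_ltn.
Qed.

Lemma lead_digit_gt0 {b a} : 1 < b -> 0 < a -> 0 < digit b a (lead_index b a).
Proof.
move=> b1 a0; have b0 := ltnW b1.
have bn0 : 0 < b ^ lead_index b a by rewrite expn_gt0 b0.
rewrite /digit modn_small ?divn_gt0 ?trunc_logP //.
by rewrite ltn_divLR // -expnS trunc_log_ltn.
Qed.

Lemma lead_index_repdigit_tail b m : 1 < b -> lead_index b (2 * b ^ m - 1) = m.
Proof.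
move=> b1; have bm0 : 0 < b ^ m by rewrite expn_gt0 ltnW.
apply: trunc_log_eq => //; rewrite expnS.
have : 2 * b ^ m <= b * b ^ m by rewrite leq_mul2r b1 orbT.
by lia.
Qed.

(** With [d = m - i], the number is [(2 * b ^ d - 1) * b ^ i + (b ^ i - 1)], so
    the digit at [i] is the last digit of [2 * b ^ d - 1]. *)
Lemma digit_repdigit_tail b m i : 1 < b -> i <= m ->
  digit b (2 * b ^ m - 1) i = if i == m then 1 else b.-1.
Proof.
move=> b1 /subnKC; move: (m - i) => d <-.
have b0 := ltnW b1; have bi0 : 0 < b ^ i by rewrite expn_gt0 b0.
have bd0 : 0 < b ^ d by rewrite expn_gt0 b0.
have -> : 2 * b ^ (i + d) - 1 = (2 * b ^ d - 1) * b ^ i + (b ^ i).-1.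
  by rewrite expnD; nia.
rewrite /digit divnMDl // divn_small ?prednK // addn0.
case: d bd0 => [|d] bd0; first by rewrite addn0 eqxx expn0 modn_small.
rewrite ifF; last by lia.
have bd1 : 0 < b ^ d by rewrite expn_gt0 b0.
have -> : 2 * b ^ d.+1 - 1 = (2 * b ^ d - 1) * b + b.-1 by rewrite expnS; nia.
by rewrite modnMDl modn_small ?prednK.
Qed.

(** * Values of the elated function *)

Lemma elated_fun_lead1 b a : digit b a (lead_index b a) = 1 ->
  elated_fun b a = 1 + \sum_(i < lead_index b a) digit b a i ^ 2.
Proof. by move=> l1; rewrite /elated_fun big_ord_recr /= l1 mul1n addnC. Qed.

Lemma elated_fun_repdigit_tail b m : 1 < b ->
  elated_fun b (2 * b ^ m - 1) = 1 + b.-1 ^ 2 * m.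
Proof.
move=> b1; have l1 : digit b (2 * b ^ m - 1) (lead_index b (2 * b ^ m - 1)) = 1.
  by rewrite lead_index_repdigit_tail // digit_repdigit_tail // eqxx.
rewrite elated_fun_lead1 // lead_index_repdigit_tail //.
rewrite (eq_bigr (fun=> b.-1 ^ 2)) => [|i _].
  by rewrite sum_nat_const card_ord mulnC.
by rewrite digit_repdigit_tail ?ltn_eqF // ltnW.
Qed.

(** Each of the [n] digits below the leading 1 contributes at most
    [(b - 1) ^ 2], so [m <= n].  If [m < n] then [a] is too long to be smaller,
    and if [m = n] then all these digits must be [b - 1]. *)
Lemma repdigit_tail_minimal b a m : 1 < b ->
  digit b a (lead_index b a) = 1 ->
  1 + b.-1 ^ 2 * m <= elated_fun b a -> 2 * b ^ m - 1 <= a.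
Proof.
move=> b1 l1; rewrite elated_fun_lead1 // leq_add2l => le_m.
have b0 := ltnW b1; have := sum_digits a b1; rewrite l1 mul1n.
move: (lead_index b a) le_m => n le_m aE.
have sq_le (i : 'I_n) :
    digit b a i ^ 2 <= b.-1 ^ 2 ?= iff (digit b a i == b.-1).
  apply/leqifP; case: eqP => [->//|].
  by have := ltn_digit a i b0; rewrite ltn_sqr; lia.
have [] := leqif_sum (fun i (_ : true) => sq_le i).
rewrite sum_nat_const card_ord mulnC => le_n eq_n.
have le_mn : m <= n.
  move: (leq_trans le_m le_n).
  by rewrite leq_pmul2l // expn_gt0 -ltnS prednK ?b1.
have bm0 : 0 < b ^ m by rewrite expn_gt0 b0.
case: (ltngtP m n) le_mn => // [lt_mn _|mn _].
  have : b ^ m.+1 <= b ^ n by rewrite leq_pexp2l.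
  rewrite expnS; have : 2 * b ^ m <= b * b ^ m by rewrite leq_mul2r b1 orbT.
  by lia.
subst n; move: eq_n; rewrite eqn_leq le_n le_m => /esym/forallP digE.
have aE' : \sum_(i < m) digit b a i * b ^ i = (b ^ m).-1.
  rewrite predn_exp big_distrr /=; apply: eq_bigr => i _.
  by rewrite (eqP (implyP (digE i) isT)).
by move: aE; rewrite aE'; lia.
Qed.

(** * Parity in odd bases *)

(** All powers of [b] are odd, and squaring preserves parity. *)
Lemma odd_sum_sqr_digits b a : odd b -> 1 < b ->
  odd (\sum_(i < (lead_index b a).+1) digit b a i ^ 2) = odd a.
Proof.
move=> ob b1; rewrite [in RHS](sum_digits a b1) big_ord_recr /= !oddD.
rewrite oddX oddM oddX ob orbT andbT; congr (_ (+) _).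
rewrite !(big_morph odd oddD (erefl (odd 0))); apply: eq_bigr => i _.
by rewrite oddM !oddX ob orbT andbT.
Qed.

Lemma odd_elated_fun b a : odd b -> 1 < b ->
  odd (elated_fun b a) = odd (digit b a (lead_index b a)) && odd a.
Proof. by move=> ob b1; rewrite /elated_fun oddM odd_sum_sqr_digits. Qed.

Lemma elated_odd {b a} : odd b -> 1 < b -> elated b a -> odd a.
Proof.
move=> ob b1 [_ [m]]; elim: m a => [|m IHm] a; first by move=> /= ->.
by rewrite iterSr => /IHm; rewrite odd_elated_fun // => /andP[].
Qed.

(** * Heights *)

Lemma elated_fun_gt0 b a : 1 < b -> 0 < a -> 0 < elated_fun b a.
Proof.
move=> b1 a0; have l0 := lead_digit_gt0 b1 a0.
by rewrite /elated_fun muln_gt0 l0 big_ord_recr /= addn_gt0 expn_gt0 l0 orbT.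
Qed.

Lemma elated_image {b a k} : 1 < b -> elated b a -> has_height b a k.+1 ->
  elated b (elated_fun b a) /\ has_height b (elated_fun b a) k.
Proof.
move=> b1 [a0 _] []; rewrite iterSr => ek min_k; split.
  by split; [exact: elated_fun_gt0 | exists k].
by split=> // m em; rewrite -ltnS min_k // iterSr.
Qed.

Lemma elated_preimage {b a k} : 1 < a ->
  has_height b (elated_fun b a) k -> elated b a /\ has_height b a k.+1.
Proof.
move=> a1 [ek min_k]; split.
  by split; [exact: ltnW | exists k.+1; rewrite iterSr].
split; first by rewrite iterSr.
by case=> [/= a_eq1|m]; [rewrite a_eq1 in a1 | rewrite iterSr => /min_k].
Qed.

Lemma elated_odd_lead {b a k} : odd b -> 1 < b -> elated b a ->
  has_height b a k.+1 -> odd (digit b a (lead_index b a)).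
Proof.
move=> ob b1 ela hta; have [elEa _] := elated_image b1 ela hta.
by move: (elated_odd ob b1 elEa); rewrite odd_elated_fun // => /andP[].
Qed.

(** * Least elated numbers in base 3 *)

(** Among the digits 0, 1 and 2 only 1 is odd. *)
Lemma elated3_lead1 {a k} : elated 3 a -> has_height 3 a k.+1 ->
  digit 3 a (lead_index 3 a) = 1.
Proof.
move=> ela hta; have := @elated_odd_lead 3 a k isT isT ela hta.
have : digit 3 a (lead_index 3 a) < 3 by rewrite ltn_digit.
by case: (digit 3 a _) => [|[|[|d]]].
Qed.

Lemma epsilon_step k m : 0 < m -> is_epsilon k 3 (1 + 4 * m) ->
  is_epsilon k.+1 3 (2 * 3 ^ m - 1).
Proof.
move=> m0 [_ ht_e min_e].
have e'1 : 1 < 2 * 3 ^ m - 1.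
  by have : 3 ^ 1 <= 3 ^ m by [rewrite leq_exp2l]; lia.
have ht_Ee' : has_height 3 (elated_fun 3 (2 * 3 ^ m - 1)) k.
  by rewrite elated_fun_repdigit_tail.
have [ele' hte'] := elated_preimage e'1 ht_Ee'.
split=> // a ela hta; apply: repdigit_tail_minimal => //.
  exact: elated3_lead1 ela hta.
by have [] := elated_image (isT : 1 < 3) ela hta; apply: min_e.
Qed.

(** Big operators do not reduce, while the sum of a list can be evaluated. *)
Lemma elated_fun_sumn b a : elated_fun b a =
  digit b a (lead_index b a)
  * sumn [seq digit b a i ^ 2 | i <- iota 0 (lead_index b a).+1].
Proof.
rewrite /elated_fun -(big_mkord xpredT (fun i => digit b a i ^ 2)).
by rewrite sumnE big_map /index_iota subn0.
Qed.

Lemma epsilon2 : is_epsilon 2 3 13.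
Proof.
have E13 : elated_fun 3 13 = 3 by rewrite elated_fun_sumn; vm_compute.
have E3 : elated_fun 3 3 = 1 by rewrite elated_fun_sumn; vm_compute.
have ht1 : has_height 3 (elated_fun 3 3) 0 by rewrite E3.
have [_ ht3] := elated_preimage (isT : 1 < 3) ht1.
have ht3' : has_height 3 (elated_fun 3 13) 1 by rewrite E13.
have [el13 ht13] := elated_preimage (isT : 1 < 13) ht3'.
split=> // a [a0 _] [/= ea min2]; rewrite leqNgt; apply/negP => a13.
(* Of the numbers below 13, only 1, 3 and 9 reach 1 in two steps, but these
   reach it earlier. *)
move: a0 ea (min2 0) (min2 1); rewrite /= !elated_fun_sumn.
move: a13 {min2}; do 13?[case: a => [|a] //]; vm_compute => //.
all: by move=> _ _ _ h0 h1; first [have := h0 erefl | have := h1 erefl].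
Qed.

Theorem theorem12 (k : nat) (hk : 2 <= k) :
  exists e e' : nat,
    [/\ is_epsilon k 3 e, is_epsilon k.+1 3 e', 4 %| e - 1 &
        e' = 2 * 3 ^ ((e - 1) %/ 4) - 1].
Proof.
have [m m0 eps_k] : exists2 m, 0 < m & is_epsilon k 3 (1 + 4 * m).
  elim: k hk => // k IHk; rewrite leq_eqVlt => /predU1P[<-|/IHk [m m0 eps_k]].
    by exists 3 => //; exact: epsilon2.
  (* As [3 ^ m] is odd, [2 * 3 ^ m - 1 = 1 + 4 * (3 ^ m)./2]. *)
  exists (3 ^ m)./2; first by have : 3 ^ 1 <= 3 ^ m by [rewrite leq_exp2l]; lia.
  have := odd_double_half (3 ^ m); rewrite oddX orbT => m_half.
  by have -> : 1 + 4 * (3 ^ m)./2 = 2 * 3 ^ m - 1; [lia | exact: epsilon_step].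
exists (1 + 4 * m), (2 * 3 ^ m - 1); rewrite addKn mulKn // dvdn_mulr //.
by split=> //; exact: epsilon_step.
Qed.
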